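(* Let $E$ be a Fréchet space and let $f,\gamma\colon[a,b]\to E'$ be weak-$*$ continuous and such that $\gamma$ is weak-$*$ $C^1$ with $\frac{d}{dt}[\gamma(t)(y)]=f(t)(y)$ for every $y\in E$ (equivalently, $\gamma(t)(y)=\gamma(a)(y)+\int_a^t f(s)(y)\,ds$ for all $t\in[a,b]$, $y\in E$). Then for every $w\in C^{1}([a,b],E)$ the function $t\mapsto\gamma(t)(w(t))$ is $C^{1}$, with $$\frac{d}{dt}\bigl[\gamma(t)(w(t))\bigr]=f(t)(w(t))+\gamma(t)(w'(t)).$$
   Context: $E'$ denotes the continuous dual of the (real) Fréchet space $E$. A map $\ell\colon J\to E'$ ($J\subset\mathbb{R}$ an interval) is called weak-$*$ continuous (resp. weak-$*$ $C^1$) if the scalar function $t\mapsto\ell(t)(y)$ is continuous (resp. $C^1$) for each $y\in E$. *)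

(* Defs.v *)
From HB Require Import structures.
From mathcomp Require Import all_boot all_order all_algebra.
From mathcomp Require Import all_classical all_reals all_analysis.

Set Implicit Arguments.
Unset Strict Implicit.
Unset Printing Implicit Defensive.

Import Order.TTheory GRing.Theory Num.Theory.
Import numFieldNormedType.Exports.

Local Open Scope classical_set_scope.
Local Open Scope ring_scope.

(* A Fréchet space is a locally convex space (already part of [tvsType]) whose
   topology is induced by a complete translation-invariant metric.  The
   uniform structure carried by a [tvsType] is deliberately not used:
   [tvsType] does not force it to be the translation-invariant one, so
   completeness for it would not be the completeness of the vector space. *)
Definition frechet_space (R : realType) (E : tvsType R) : Prop :=
  exists d : E -> E -> R,
    [/\ (forall x y, d x y = 0 <-> x = y),
        (forall x y, d x y = d y x),
        (forall x y z, d x z <= d x y + d y z) &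
        (forall x y z, d (x + z) (y + z) = d x y)] /\
    [/\ (forall (x : E) (U : set E),
          nbhs x U <-> exists2 e : R, 0 < e & [set y | d x y < e] `<=` U) &
        (forall u : nat -> E,
          (forall e : R, 0 < e -> exists N : nat,
             forall m n : nat, (N <= m)%N -> (N <= n)%N -> d (u m) (u n) < e) ->
          exists l : E, u @ \oo --> l)].

Record dual (R : realType) (E : tvsType R) := Dual {
  dual_fun :> {linear E -> R^o} ;
  dual_continuous : continuous dual_fun
}.

(* Derivative at [t] relative to [A]: one-sided at an endpoint of an
   interval. *)
Definition has_derivative_within (R : realType) (E : tvsType R)
    (A : set R) (g : R -> E) (t : R) (l : E) : Prop :=
  (fun s : R => (s - t)^-1 *: (g s - g t)) @ within A t^' --> l.

(* [g] is C^1 on [A] with derivative [g'].  Maps on [A] are represented by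
   total functions whose values outside [A] play no role. *)
Definition C1_with_derivative (R : realType) (E : tvsType R)
    (A : set R) (g g' : R -> E) : Prop :=
  (forall t : R, A t -> has_derivative_within A g t (g' t)) /\
  {within A, continuous g'}.

Definition C1_on (R : realType) (E : tvsType R) (A : set R) (g : R -> E) : Prop :=
  exists g' : R -> E, C1_with_derivative A g g'.

Definition weak_star_continuous (R : realType) (E : tvsType R)
    (A : set R) (l : R -> dual E) : Prop :=
  forall y : E, {within A, continuous (fun t : R => l t y)}.

Definition weak_star_C1 (R : realType) (E : tvsType R)
    (A : set R) (l : R -> dual E) : Prop :=
  forall y : E, C1_on A (fun t : R => l t y).

(* Main.v *)
(* A weak-* continuous curve in E' on a compact interval is pointwise bounded,
   hence equicontinuous by Banach-Steinhaus; so h(s)(v(s)) -> h(t)(v0) whenever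
   v(s) -> v0 in E.  This is applied to the first term of
     (s - t)^-1 (gamma_s(w s) - gamma_t(w t))
       = gamma_s((s - t)^-1 (w s - w t))
         + (s - t)^-1 (gamma_s(w t) - gamma_t(w t)),
   and again for the continuity of the resulting derivative. *)

Require Import Defs.
From mathcomp Require Import all_boot all_order all_algebra.
From mathcomp Require Import all_classical all_reals all_analysis.
From mathcomp Require Import lra.
Import numFieldNormedType.Exports.
Local Open Scope classical_set_scope.
Local Open Scope ring_scope.

Import Order.TTheory GRing.Theory Num.Theory.

Set Implicit Arguments.
Unset Strict Implicit.
Unset Printing Implicit Defensive.

Lemma cvg_tvsD (R : numFieldType) (E : tvsType R) (T : Type)
    (F : set_system T) {FF : Filter F} (f g : T -> E) (x y : E) :
  f @ F --> x -> g @ F --> y -> (fun t => f t + g t) @ F --> x + y.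
Proof.
move=> fx gy.
apply: (@continuous2_cvg _ _ _ _ F FF f g (fun u v : E => u + v) x y _ fx gy).
exact: (@add_continuous E (x, y)).
Qed.

Lemma cvg_tvsB (R : numFieldType) (E : tvsType R) (T : Type)
    (F : set_system T) {FF : Filter F} (f g : T -> E) (x y : E) :
  f @ F --> x -> g @ F --> y -> (fun t => f t - g t) @ F --> x - y.
Proof.
move=> fx gy.
apply: (@continuous2_cvg _ _ _ _ F FF f g (fun u v : E => u - v) x y _ fx gy).
exact: (@sub_continuous E (x, y)).
Qed.

Lemma cvg_tvsZ (R : numFieldType) (E : tvsType R) (T : Type)
    (F : set_system T) {FF : Filter F} (k : T -> R) (g : T -> E) (c : R) (y : E) :
  k @ F --> c -> g @ F --> y -> (fun t => k t *: g t) @ F --> c *: y.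
Proof.
move=> kc gy.
apply: (@continuous2_cvg T R^o E E F FF k g (fun u (v : E) => u *: v) c y _ kc gy).
exact: (@scale_continuous R E (c, y)).
Qed.

(* Nested balls: otherwise each ball contains a smaller closed ball on which
   some member of the family exceeds any prescribed bound, and the limit of
   the centres contradicts pointwise boundedness. *)
Lemma pointwise_bounded_ball (R : realType) (E : tvsType R)
    (d : E -> E -> R)
    (d0 : forall x y, d x y = 0 <-> x = y)
    (dC : forall x y, d x y = d y x)
    (dD : forall x y z, d x z <= d x y + d y z)
    (dnbhs : forall (x : E) (U : set E),
       nbhs x U <-> exists2 e : R, 0 < e & [set y | d x y < e] `<=` U)
    (dcomplete : forall u : nat -> E,
       (forall e : R, 0 < e -> exists N : nat,
          forall m n : nat, (N <= m)%N -> (N <= n)%N -> d (u m) (u n) < e) ->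
       exists l : E, u @ \oo --> l)
    (I : Type) (l : I -> dual E)
    (hl : forall y : E, exists M : R, forall i, `|l i y| <= M) :
  exists (x : E) (r M : R), 0 < r /\
    forall i y, d x y < r -> `|l i y| <= M.
Proof.
apply: contrapT => H.
(* A pair stands for a centre and a radius. The existential precedes the premise [0 < p.2], so that
   [choice] yields a function on all pairs. *)
have step (n : nat) (p : E * R) : exists q : E * R, 0 < p.2 ->
    [/\ 0 < q.2, q.2 <= p.2 / 2, q.2 <= n.+1%:R^-1, d p.1 q.1 < p.2 / 2 &
      exists i, forall z, d q.1 z <= q.2 -> n%:R < `|l i z|].
  have [p0|p0] := ltP 0 p.2; last by exists p.
  have [i [y [py ly]]] : exists i y, d p.1 y < p.2 / 2 /\ n%:R < `|l i y|.
    apply: contrapT => K; apply: H; exists p.1, (p.2 / 2), n%:R.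
    split=> [|i y py]; first by rewrite divr_gt0.
    by rewrite leNgt; apply/negP => ly; apply: K; exists i, y.
  have /dnbhs[e e0 ye] : nbhs y [set z | n%:R < `|l i z|].
    have /cvg_norm : l i z @[z --> y] --> l i y by apply: dual_continuous.
    by move=> lyz; exact: (cvgr_gt _ lyz _ ly).
  (* [e / 2] puts the closed ball inside the open [e]-ball where [l i] exceeds [n], [p.2 / 2] nests
     the balls, and the last term sends the radii to 0. *)
  exists (y, Num.min (e / 2) (Num.min (p.2 / 2) n.+1%:R^-1)) => _ /=; split.
  - by rewrite !lt_min !divr_gt0//= invr_gt0.
  - by rewrite !ge_min lexx orbT.
  - by rewrite !ge_min lexx !orbT.
  - by [].
  - exists i => z; rewrite !le_min => /andP[yz _]; apply: ye => /=.
    by apply: le_lt_trans yz _; rewrite ltr_pdivrMr// ltr_pMr// ltr1n.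
have /choice[g gP] (np : nat * (E * R)) := step np.1 np.2.
pose p := fix p n := if n is m.+1 then g (m, p m) else (0 : E, 1 : R).
have p_gt0 n : 0 < (p n).2.
  by elim: n => [|n IH] /=; [exact: ltr01|case: (gP (n, p n) IH)].
have pP n : [/\ (p n.+1).2 <= (p n).2 / 2, (p n.+1).2 <= n.+1%:R^-1,
      d (p n).1 (p n.+1).1 < (p n).2 / 2 &
      exists i, forall z, d (p n.+1).1 z <= (p n.+1).2 -> n%:R < `|l i z|].
  by case: (gP (n, p n) (p_gt0 n)).
clearbody p.
(* Moving to the next centre costs less than half of the radius; by induction all further moves cost
   less than the next radius, at most the other half. *)
have dp k n : d (p n).1 (p (n + k)%N).1 < (p n).2.
  elim: k n => [|k IH] n; first by rewrite addn0 (d0 _ _).2.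
  rewrite addnS -addSn; apply: le_lt_trans (dD _ (p n.+1).1 _) _.
  by have [+ _ + _] := pP n; have := IH n.+1; lra.
have {}dp n m : (n <= m)%N -> d (p n).1 (p m).1 < (p n).2.
  by move=> /subnKC <-.
have [e e0|x px] := dcomplete (fun n => (p n).1).
  have e20 : 0 < e / 2 by rewrite divr_gt0.
  (* The radius at stage [N.+1] is below [e / 2], so any two later centres are within [e]. *)
  have [N _ Ne] := @near_infty_natSinv_lt R (PosNum e20).
  exists N.+1 => m n Nm Nn /=.
  have [_ /le_lt_trans /(_ (Ne N (leqnn N))) /= + _ _] := pP N.
  have := dp _ _ Nm; have := dp _ _ Nn; have := dD (p m).1 (p N.+1).1 (p n).1.
  rewrite (dC (p m).1 (p N.+1).1).
  by lra.
(* The limit satisfies only a weak inequality, which is why [step] controls [l i] on closed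
   balls. *)
have dpx n : d (p n).1 x <= (p n).2.
  apply/ler_addgt0Pl => e e0.
  have [N _ Ne] : \forall m \near \oo, d x (p m).1 < e.
    by apply: (px [set y | d x y < e]); apply/dnbhs; exists e.
  have := Ne (maxn N n) (leq_maxl _ _) => /=.
  have := dp n (maxn N n) (leq_maxr _ _).
  by rewrite (dC x); have := dD (p n).1 (p (maxn N n)).1 x; lra.
have [M HM] := hl x.
(* Some [l i] exceeds [(Num.truncn M).+1], hence [M], at the limit [x]. *)
have [_ _ _ [i /(_ x (dpx _))]] := pP (Num.truncn M).+1.
apply/negP; rewrite -leNgt; apply: le_trans (HM i) _.
exact/ltW/truncnS_gt.
Qed.

(** Banach-Steinhaus: translation invariance and linearity carry the bound from a ball about [x] to
    one about 0, and scaling that ball by [e / K] brings the bound down to [e]. *)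
Lemma frechet_equicontinuous (R : realType) (E : tvsType R)
    (hE : frechet_space E) (I : Type) (l : I -> dual E)
    (hl : forall y : E, exists M : R, forall i, `|l i y| <= M)
    (e : R) (e0 : 0 < e) :
  \forall x \near (0 : E), forall i, `|l i x| <= e.
Proof.
have [d [[d0 dC dD dT] [dnbhs dcomplete]]] := hE.
have [x [r [M [r0 HM]]]] :=
  @pointwise_bounded_ball R E d d0 dC dD dnbhs dcomplete I l hl.
(* Two terms bound [l i (z + x) - l i x]; the added 1 makes [K] positive. *)
pose K : R := `|M| + `|M| + 1.
have K0 : 0 < K by rewrite ltr_wpDl// addr_ge0.
have bK z i : d 0 z < r -> `|l i z| <= K.
  move=> zr; rewrite -[z](addrK x) linearB.
  apply: le_trans (ler_normB _ _) _.
  have := HM i x; rewrite (d0 _ _).2// => /(_ r0).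
  have := HM i (z + x); rewrite -{1}[x]add0r dT => /(_ zr).
  by have := ler_norm M; rewrite /K; lra.
have /nbhs0Z : nbhs (0 : E) [set y | d 0 y < r] by apply/dnbhs; exists r.
move=> /(_ (e / K)); rewrite mulf_eq0 invr_eq0 !gt_eqF//= => /(_ isT).
apply: filterS => _ [z zr <-] i.
rewrite linearZ /= normrM gtr0_norm ?divr_gt0//.
by rewrite mulrAC ler_pdivrMr// ler_wpM2l ?bK// ltW.
Qed.

Lemma weak_star_continuous_bounded (R : realType) (E : tvsType R) (a b : R)
    (h : R -> dual E) (hh : weak_star_continuous `[a, b] h) (y : E) :
  exists M : R, forall t, a <= t <= b -> `|h t y| <= M.
Proof.
have /compact_bounded : compact ((fun t => h t y : R^o) @` `[a, b]%classic).
  by apply: continuous_compact (hh y) _; exact: segment_compact.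
move=> [M [_ /(_ (M + 1))]]; rewrite ltrDl ltr01 => /(_ isT) HM.
exists (M + 1) => t tab; apply: (HM (h t y)).
by exists t => //=; rewrite in_itv.
Qed.

(* [F] stands for both [within `[a, b] (nbhs t)] and its punctured version. *)
Lemma cvg_weak_star_pairing (R : realType) (E : tvsType R)
    (hE : frechet_space E) (a b : R) (h : R -> dual E)
    (hh : weak_star_continuous `[a, b] h)
    (F : set_system R) {FF : Filter F} (Fab : F `[a, b]%classic)
    (v : R -> E) (v0 : E) (c : R) :
  v @ F --> v0 -> (fun s => h s v0 : R^o) @ F --> (c : R^o) ->
  (fun s => h s (v s) : R^o) @ F --> (c : R^o).
Proof.
move=> vv0 hc.
have -> : (fun s => h s (v s) : R^o) =
    (fun s => (h s (v s - v0) : R^o) + h s v0).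
  by apply/funext => s; rewrite -linearD subrK.
rewrite -[c]add0r; apply: (@cvg_tvsD R R^o) => //.
apply/cvgrPdist_le => e e0.
(* Boundedness is known only over [[a, b]], so the family is indexed by the subtype. *)
have bd y : exists M : R, forall i : {t | a <= t <= b}, `|h (sval i) y| <= M.
  have [M HM] := weak_star_continuous_bounded hh y.
  by exists M => -[t tab] /=; apply: HM.
have vB : (fun s => v s - v0) @ F --> (0 : E).
  by rewrite -[X in _ --> X](subrr v0); apply: cvg_tvsB => //; exact: cvg_cst.
have Fe : \forall s \near F, forall i : {t | a <= t <= b},
    `|h (sval i) (v s - v0)| <= e by exact: vB (frechet_equicontinuous hE bd e0).
apply: (filterS2 _ _ Fab Fe) => s; rewrite /= in_itv /= => sab H.
by rewrite sub0r normrN; exact: (H (exist _ s sab)).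
Qed.

(** At [s = t] the value is [g t] itself, which lies in each of its neighbourhoods. *)
Lemma cvg_within_of_dnbhs (R : realType) (T : topologicalType) (A : set R) (t : R)
    (g : R -> T) :
  g @ within A t^' --> g t -> g @ within A (nbhs t) --> g t.
Proof.
move=> gt U Ut.
have gU : nbhs t (fun s => s != t -> A s -> U (g s)) := gt U Ut.
change (nbhs t (fun s => A s -> U (g s))); apply: filterS gU => s H As.
have [->|st] := eqVneq s t; first exact: nbhs_singleton.
exact: H.
Qed.

Lemma has_derivative_within_cvg (R : realType) (E : tvsType R) (A : set R)
    (g : R -> E) (t : R) (l : E) :
  has_derivative_within A g t l -> g @ within A (nbhs t) --> g t.
Proof.
move=> gl; apply: cvg_within_of_dnbhs.
have st0 : (fun s : R => s - t) @ within A t^' --> (0 : R).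
  rewrite -[X in _ --> X](subrr t); apply: cvgB; last exact: cvg_cst.
  by apply: cvg_within_filter; exact: cvg_within.
have FF : Filter (within A t^') by exact: within_filter.
(* Multiplying the difference quotient by [s - t] gives [g s - g t] for [s != t], with limit
   [0 *: l]. *)
have gt0 := cvg_tvsZ (FF := FF) st0 gl; rewrite scale0r in gt0.
have := cvg_tvsD (FF := FF) gt0 (cvg_cst (g t) (FF := FF)).
rewrite add0r => gt1; apply: cvg_trans gt1; apply: near_eq_cvg.
change (nbhs t (fun s => s != t -> A s ->
  (s - t) *: ((s - t)^-1 *: (g s - g t)) + g t = g s)).
apply: (@filterE _ (nbhs t)) => s st _.
by rewrite scalerA mulfV ?subr_eq0// scale1r subrK.
Qed.

Theorem lemma3p6 (R : realType) (E : tvsType R) (hE : frechet_space E)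
    (a b : R) (hab : a < b) (f gamma : R -> dual E)
    (hf : weak_star_continuous `[a, b] f)
    (hgamma : weak_star_continuous `[a, b] gamma)
    (hgamma1 : weak_star_C1 `[a, b] gamma)
    (hder : forall y : E, forall t : R, t \in `[a, b] ->
       has_derivative_within `[a, b] (fun s : R => gamma s y) t (f t y))
    (w w' : R -> E) (hw : C1_with_derivative `[a, b] w w') :
  C1_with_derivative `[a, b] (fun t : R => gamma t (w t))
    (fun t : R => f t (w t) + gamma t (w' t)).
Proof.
have [dw cw'] := hw.
have in_within (F : set_system R) : Filter F -> within `[a, b] F `[a, b]%classic.
  by move=> FF; rewrite /within /=; exact: nearW.
split=> [t tab|].
  have -> : f t (w t) + gamma t (w' t) = gamma t (w' t) + f t (w t) by rewrite addrC.
  rewrite /has_derivative_within.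
  have -> : (fun s : R => (s - t)^-1 *: ((gamma s (w s) : R^o) - gamma t (w t))) =
      (fun s => (gamma s ((s - t)^-1 *: (w s - w t)) : R^o) +
         (s - t)^-1 *: ((gamma s (w t) : R^o) - gamma t (w t))).
    apply/funext => s; rewrite linearZ /= -scalerDr (linearB (gamma s)).
    by rewrite addrA subrK.
  have FF : Filter (within `[a, b] t^') by exact: within_filter.
  apply: (@cvg_tvsD R R^o _ _ FF); last by apply: hder; rewrite inE.
  apply: (cvg_weak_star_pairing hE hgamma) (dw t tab) _; first exact: in_within.
  (* Weak-* continuity at the fixed vector [w' t], restricted to the punctured filter. *)
  have /subspace_continuousP/(_ t tab) := hgamma (w' t).
  apply: cvg_trans => U; rewrite /within /=; exact: nbhs_dnbhs.
(* Continuity of the derivative: the first summand uses continuity of [w], a consequence of its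
   differentiability, and the second that of [w']. *)
apply/subspace_continuousP => t tab.
apply: (@cvg_tvsD R R^o).
  apply: (cvg_weak_star_pairing hE hf); first exact: in_within.
    exact: has_derivative_within_cvg (dw t tab).
  by have /subspace_continuousP := hf (w t); apply.
apply: (cvg_weak_star_pairing hE hgamma); first exact: in_within.
  by have /subspace_continuousP := cw'; apply.
by have /subspace_continuousP := hgamma (w' t); apply.
Qed.
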